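(* Let $k\ge1$ be an integer, $n=2k$, $\pi=(1,2)(3,4)\cdots(2k-1,2k)\in S_n$, and write $\overline{i}=i^\pi$. Let $P=3^{1+2}$ be the extraspecial group of order 27 and exponent 3 with generators $u,v$ and $w=[u,v]=u^{-1}v^{-1}uv$, and let $\sigma$ be the involutive automorphism of $P$ interchanging $u$ and $v$. Let $\tau$ be the automorphism of the Fischer space of $Wr(P,n)$ given by $$(g.(i,j))^\tau=g^\sigma.(\overline{i},\overline{j})\quad(g\in P),\qquad\text{i.e. } (u^rv^sw^t.(i,j))^\tau=v^ru^sw^{-t}.(\overline{i},\overline{j})=u^sv^rw^{-t-sr}.(\overline{i},\overline{j}),$$ and let $H=\langle\tau\rangle$. Then the fixed subalgebra $M_H$ of the Matsuo algebra $M=M_\eta(Wr(3^{1+2},n))$ has dimension $27k^2-9k$. Among the $H$-orbit vectors, there are - $9k$ singles $u^rv^sw^t.(2i-1,2i)$, where $0\le r,s,t\le 2$, $r+s\equiv0\pmod 3$ and $1\le i\le k$; - $27k(k-1)$ doubles $g.(i,j)+g^\sigma.(\overline{i},\overline{j})$, where $g\in P$ and $\overline{i}\neq j$; - $9k$ extras $u^rv^sw^t.(2i-1,2i)+u^{2s}v^{2r}w^t.(2i-1,2i)$, where $0\le r,s,t\le 2$, $r+s\not\equiv0\pmod 3$ and $1\le i\le k$.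
   Context: For a group $T$ all of whose elements have order 1, 2 or 3 and an integer $n\ge 2$, let $T\operatorname{wr}S_n=T^n\rtimes S_n$ be the wreath product, with $S_n$ acting naturally on coordinates; for $t\in T$ let $t_i$ be the image of $t$ in the $i$-th factor of $T^n$. The group $Wr(T,n)$ is the subgroup of $T\operatorname{wr}S_n$ generated by the conjugacy class $D$ (in $T\operatorname{wr}S_n$) of a transposition of $S_n$. One has $D=\{t.(i,j)\mid t\in T, 1\le i<j\le n\}$, where $t.(i,j):=t_it_j^{-1}(i,j)$, with $t.(i,j)=t^{-1}.(j,i)$, and $D$ is a class of 3-transpositions: it is a normal generating set of involutions with $|cd|\le3$ for all $c,d\in D$. Here $T=P=3^{1+2}$; $w$ has order 3 and commutes with $u$ and $v$, and each element of $P$ is uniquely $u^rv^sw^t$ with $0\le r,s,t\le2$. Let $\mathbb{F}$ be a field of characteristic not two and $\eta\in\mathbb{F}\setminus\{0,1\}$. The Matsuo algebra $M_\eta(G,D)$ (also written $M_\eta(G)$) of a 3-transposition group $(G,D)$ is the commutative $\mathbb{F}$-algebra with basis $D$ and product $c\cdot c=c$; $c\cdot d=0$ if $|cd|=2$; $c\cdot d=\frac{\eta}{2}(c+d-c^d)$ if $|cd|=3$. The Fischer space has point set $D$ and lines $\{c,d,c^d\}$ for $c,d\in D$ with $|cd|=3$; its automorphisms act on $M_\eta(G,D)$ by permuting $D$. For a group $H$ of such automorphisms, $M_H=\{u\in M\mid u^h=u\text{ for all }h\in H\}$ is the fixed subalgebra; the orbit vectors $\sum_{c\in O}c$, for $O$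 an $H$-orbit on $D$, form a basis of $M_H$. If $H=\langle\tau\rangle$ with $|\tau|=2$, an orbit vector is a single if it is $a\in D$ with $\{a\}$ an orbit of length 1; a double if it is $a+b$ with $\{a,b\}$ an orbit of length 2 and $a\cdot b=0$; an extra if it is $a+b$ with $\{a,b\}$ an orbit of length 2 and $a\cdot b\neq0$. *)

(* Defs.v *)
From HB Require Import structures.
From mathcomp Require Import all_boot all_order all_fingroup all_algebra.
From mathcomp Require Import all_solvable.

Set Implicit Arguments.
Unset Strict Implicit.
Unset Printing Implicit Defensive.

Import GroupScope GRing.Theory.

(* P holds for exactly n values. *)
Definition has_card (A : eqType) (P : A -> Prop) (n : nat) : Prop :=
  exists s : seq A, [/\ uniq s, size s = n & forall x, x \in s <-> P x].

Section Matsuo.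

Variables (gT : finGroupType) (D : {set gT}).

Definition point : finType := {c : gT | c \in D}.

Definition fischer_lines : {set {set point}} :=
  [set L | [exists c : point, exists d : point,
     (#[val c * val d] == 3) &&
     (L == [set z | val z \in [set val c; val d; val c ^ val d]])]].

Definition fischer_aut (h : {perm point}) : Prop :=
  forall L : {set point}, (h @: L \in fischer_lines) = (L \in fischer_lines).

Variable F : fieldType.

(* The underlying space of the Matsuo algebra of (<<D>>, D): coordinates with
   respect to the basis D. *)
Definition matsuo : vectType F := {ffun point -> F^o}.

(* The basis vector attached to c; it is meant for c in D, and is the zero
   vector otherwise. *)
Definition bvec (c : gT) : matsuo := [ffun d : point => ((val d == c)%:R : F^o)%R].

Definition basis_mul (eta : F) (c d : gT) : matsuo :=
  if c == d then bvec c
  else if #[c * d] == 3 then ((eta / 2%:R) *: (bvec c + bvec d - bvec (c ^ d)))%R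
  else 0%R.

Definition matsuo_mul (eta : F) (x y : matsuo) : matsuo :=
  (\sum_(c : point) \sum_(d : point)
     (x c * y d : F) *: basis_mul eta (val c) (val d))%R.

(* The permutation h of D sends the basis vector of c to that of h c, hence
   the inverse on coordinates. *)
Definition matsuo_act (h : {perm point}) (x : matsuo) : matsuo :=
  [ffun c => x (h^-1 c)].

Lemma matsuo_act_linear h : linear (matsuo_act h).
Proof. by move=> a x y; apply/ffunP=> c; rewrite !ffunE. Qed.

HB.instance Definition _ h :=
  GRing.isLinear.Build F matsuo matsuo _ (matsuo_act h) (matsuo_act_linear h).

Definition fixed_subalg (H : {set {perm point}}) : {vspace matsuo} :=
  (\bigcap_(h in H) fixedSpace (linfun (matsuo_act h)))%VS.

Lemma fixed_subalgP (H : {set {perm point}}) (x : matsuo) :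
  reflect (forall h, h \in H -> matsuo_act h x = x) (x \in fixed_subalg H).
Proof.
apply: (iffP subv_bigcapP) => [xH h Hh | xH h Hh].
  by have /fixedSpaceP := xH h Hh; rewrite lfunE.
by apply/fixedSpaceP; rewrite lfunE /= xH.
Qed.

Lemma matsuo_act_bvec h (c : point) :
  matsuo_act h (bvec (val c)) = bvec (val (h c)).
Proof.
apply/ffunP=> d; rewrite !ffunE !(inj_eq val_inj).
by rewrite -(inj_eq (@perm_inj _ h)) permKV.
Qed.

Definition is_orbit_vec (H : {set {perm point}}) (x : matsuo) : Prop :=
  exists a : point, x = (\sum_(c in orbit 'P H a) bvec (val c))%R.

(* Singles, doubles and extras are used for H of order 2. *)
Definition is_single (H : {set {perm point}}) (x : matsuo) : Prop :=
  is_orbit_vec H x /\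
  exists2 a : point, orbit 'P H a = [set a] & x = bvec (val a).

Definition is_double (eta : F) (H : {set {perm point}}) (x : matsuo) : Prop :=
  is_orbit_vec H x /\
  exists a b : point, [/\ a != b, orbit 'P H a = [set a; b],
    matsuo_mul eta (bvec (val a)) (bvec (val b)) = 0%R
    & x = (bvec (val a) + bvec (val b))%R].

Definition is_extra (eta : F) (H : {set {perm point}}) (x : matsuo) : Prop :=
  is_orbit_vec H x /\
  exists a b : point, [/\ a != b, orbit 'P H a = [set a; b],
    matsuo_mul eta (bvec (val a)) (bvec (val b)) <> 0%R
    & x = (bvec (val a) + bvec (val b))%R].

End Matsuo.

Section Wreath.

Variables (T : finGroupType) (n : nat).

Definition base_group : finGroupType := {dffun forall _ : 'I_n, T}.

Definition coord (i : 'I_n) (t : T) : base_group :=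
  [ffun j => if j == i then t else 1].

(* Right action: the i-th coordinate is moved to position s i. *)
Definition permute_coords (f : base_group) (s : 'S_n) : base_group :=
  [ffun i => f (s^-1 i)].

Lemma permute_coords_is_action : is_action [set: 'S_n] permute_coords.
Proof.
split=> [s f g /ffunP fg | f s t _ _].
  by apply/ffunP=> i; have := fg (s i); rewrite !ffunE permK.
by apply/ffunP=> i; rewrite !ffunE invMg permM.
Qed.

Canonical permute_action := Action permute_coords_is_action.

Lemma permute_is_groupAction : is_groupAction [set: base_group] permute_action.
Proof.
move=> s _; rewrite /= inE; apply/andP; split.
  by apply/subsetP=> f _; rewrite inE.
apply/morphicP=> f g _ _; rewrite !actpermE /=.
by apply/ffunP=> i; rewrite !ffunE.
Qed.

Canonical permute_groupAction := GroupAction permute_is_groupAction.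

Definition wreath : finGroupType := sdprod_by permute_groupAction.

Definition in_base : base_group -> wreath := sdpair1 permute_groupAction.
Definition in_sym : 'S_n -> wreath := sdpair2 permute_groupAction.

(* t.(i,j) *)
Definition wtrans (t : T) (i j : 'I_n) : wreath :=
  in_base (coord i t) * (in_base (coord j t))^-1 * in_sym (tperm i j).

(* The elements conjugate to a transposition of S_n; since the transpositions
   are conjugate in S_n, this is a single class. Wr(T,n) is the subgroup it
   generates, and does not need a name: the Fischer space and the Matsuo
   algebra of Wr(T,n) are built from the class alone. *)
Definition wr_class : {set wreath} :=
  class_support [set in_sym (tperm p.1 p.2) | p : 'I_n * 'I_n & p.1 != p.2]
                [set: wreath].

Lemma wr_class_wtrans (x : wreath) :
  reflect (exists t, exists i, exists2 j, i != j & x = wtrans t i j)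
          (x \in wr_class).
Proof.
have conj_base f i j : i != j ->
    in_sym (tperm i j) ^ in_base f = wtrans ((f i)^-1 * f j) i j.
  move=> ij; rewrite /wtrans /conjg.
  have -> : in_sym (tperm i j) * in_base f =
            in_base (permute_coords f (tperm i j)) * in_sym (tperm i j).
    have := sdpair_act permute_groupAction (in_setT f) (in_setT (tperm i j)).
    rewrite /= -/in_base -/in_sym => ->.
    have tt : in_sym (tperm i j) * in_sym (tperm i j) = 1.
      by rewrite -[LHS](morphM (sdpair2_morphism _)) ?inE // tperm2 morph1.
    have tV : (in_sym (tperm i j))^-1 = in_sym (tperm i j).
      by apply/eqP; rewrite eq_invg_mul tt.
    by rewrite conjgE tV -!mulgA tt mulg1.
  rewrite mulgA -!(morphV (sdpair1_morphism _)) ?inE //.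
  rewrite -!(morphM (sdpair1_morphism _)) ?inE //; congr (_ * _).
  congr (sdpair1 _ _); apply/ffunP=> l; rewrite !ffunE tpermV.
  case: tpermP => [-> | -> | li lj].
  - by rewrite eqxx (negPf ij) invg1 mulg1.
  - by rewrite eq_sym (negPf ij) eqxx invMg invgK mul1g.
  - by move/eqP/negPf: li => ->; move/eqP/negPf: lj => ->; rewrite invg1 mulg1 mulVg.
apply: (iffP idP) => [/imset2P[a y /imsetP[[i j]]] |].
  rewrite inE /= => ij -> _ ->.
  rewrite [y]sdpairE conjgM -(morphJ (sdpair2_morphism _)) ?inE // tpermJ.
  have sij : y.1 i != y.1 j by rewrite (inj_eq perm_inj).
  exists ((y.2 (y.1 i))^-1 * y.2 (y.1 j)), (y.1 i), (y.1 j) => //.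
  exact: conj_base.
case=> t [i [j ij ->]].
apply/imset2P; exists (in_sym (tperm i j)) (in_base (coord i t^-1)).
- by apply/imsetP; exists (i, j); rewrite // inE.
- by rewrite inE.
rewrite conj_base // !ffunE eqxx eq_sym (negPf ij) mulg1.
by rewrite invgK.
Qed.

End Wreath.

(* {1, ..., 2k} is represented by 'I_(2 * k), all indices being shifted down
   by one: the pair (2i-1, 2i) with 1 <= i <= k becomes (2i, 2i+1) with
   0 <= i < k. *)
Lemma odd_idx_proof k (i : 'I_k) : ((2 * i)%N < (2 * k)%N)%N.
Proof. by rewrite ltn_pmul2l. Qed.

Lemma even_idx_proof k (i : 'I_k) : ((2 * i)%N.+1 < (2 * k)%N)%N.
Proof. by rewrite !mul2n -doubleS leq_double. Qed.

Definition odd_idx k (i : 'I_k) : 'I_(2 * k)%N := Ordinal (odd_idx_proof i).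
Definition even_idx k (i : 'I_k) : 'I_(2 * k)%N := Ordinal (even_idx_proof i).

Definition pairing k : 'S_(2 * k)%N :=
  \prod_(i < k) tperm (odd_idx i) (even_idx i).

Definition flip_aut (T : finGroupType) (sigma : {perm T}) k
    (tau : {perm point (wr_class T (2 * k)%N)}) : Prop :=
  fischer_aut tau /\
  forall (c : point (wr_class T (2 * k)%N)) (g : T) (i j : 'I_(2 * k)%N),
    i != j -> val c = wtrans g i j ->
    val (tau c) = wtrans (sigma g) (pairing k i) (pairing k j).

(* Main.v *)
Require Import Defs.
From mathcomp Require Import all_boot all_order all_fingroup all_algebra.
From mathcomp Require Import all_solvable.
From mathcomp Require Import zify.

Import GroupScope GRing.Theory.
Set Implicit Arguments.
Unset Strict Implicit.

(** The points of the Fischer space are the wtrans g i j with i != j, and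
    g.(i,j) = g^-1.(j,i) is the only coincidence among these names (wtrans_inj).
    The flip tau is induced by an automorphism of the whole wreath product:
    apply sigma to every coordinate, then conjugate by the pairing permutation.
    So it preserves orders of products and conjugation, hence lines; and it is
    determined by its values on the points (flip_aut_exists_unique).

    Since sigma and the pairing are involutions, so is tau, and its orbits are
    the sets {c, tau c}. There are two sorts of points.
    - Matched points g.(2i-1,2i). Here tau sends g to (sigma g)^-1 and keeps the
      pair of indices, so the point is fixed exactly when sigma g = g^-1.
      Otherwise the product of the point and its image is a nontrivial element
      of the base group, hence of order 3: the orbit vector is an extra.
    - Unmatched points g.(i,j) with j not the partner of i. Then {i,j} and
      the pair of partners are disjoint, so the point and its image are distinct
      and commute: the orbit vector is a double.
    All of this holds for any group T of exponent 3 and any involutive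
    automorphism sigma, and gives the counts in terms of |T| and of the number
    of g with sigma g = g^-1 (card_single_points, card_extra_points,
    card_double_points).

    The dimension of the fixed subalgebra is the number of orbits, because the
    orbit vectors form a basis (dim_fixed_subalg), and for an involution this is
    half the sum of the number of points and the number of fixed points.

    Only the last step concerns 3^{1+2}: in the normal form u^r v^s w^t one finds
    (sigma g)^-1 = u^{2s} v^{2r} w^t, so sigma inverts g exactly when 3 divides
    r + s, which leaves 9 of the 27 elements. *)

(** * Computing in the wreath product *)

Section WreathFacts.

Variables (T : finGroupType) (n : nat).
Implicit Types (g h t : T) (i j : 'I_n) (f : base_group T n) (s : 'S_n).

Lemma in_baseM : {morph @in_base T n : f1 f2 / f1 * f2}.
Proof. by move=> f1 f2; rewrite -(morphM (sdpair1_morphism _)) ?inE. Qed.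

Lemma in_baseV : {morph @in_base T n : f / f^-1}.
Proof. by move=> f; rewrite -(morphV (sdpair1_morphism _)) ?inE. Qed.

Lemma in_baseX m : {morph @in_base T n : f / f ^+ m}.
Proof. by move=> f; rewrite -(morphX (sdpair1_morphism _)) ?inE. Qed.

Lemma base_groupX f m i : (f ^+ m) i = f i ^+ m.
Proof. by elim: m => [|m IHm]; rewrite ?expg0 ?expgS ffunE ?IHm. Qed.

Lemma in_symM : {morph @in_sym T n : s1 s2 / s1 * s2}.
Proof. by move=> s1 s2; rewrite -(morphM (sdpair2_morphism _)) ?inE. Qed.

Lemma in_base1 : in_base 1 = 1 :> wreath T n.
Proof. exact: (morph1 (sdpair1_morphism _)). Qed.

Lemma in_sym1 : in_sym T 1 = 1 :> wreath T n.
Proof. exact: (morph1 (sdpair2_morphism _)). Qed.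

Lemma in_baseJ f s : in_base f ^ in_sym T s = in_base (permute_coords f s).
Proof.
by have := sdpair_act (permute_groupAction T n) (in_setT f) (in_setT s).
Qed.

Lemma wreath_fst f s : (in_sym T s * in_base f).1 = s.
Proof. by rewrite /= !val_insubd !inE /= mulg1. Qed.

Lemma wreath_snd f s : (in_sym T s * in_base f).2 = f.
Proof.
rewrite /= !val_insubd !inE /=.
by apply/ffunP=> i; rewrite !ffunE mul1g.
Qed.

(** This exchanges the two ways of writing an element: wtrans puts the base
    component on the left, whereas the semidirect product stores it on the
    right. *)
Lemma base_symC f s :
  in_base f * in_sym T s = in_sym T s * in_base (permute_coords f s).
Proof. by rewrite -in_baseJ -conjgC. Qed.

Lemma wreath_mul f1 f2 s1 s2 :
  in_sym T s1 * in_base f1 * (in_sym T s2 * in_base f2) =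
  in_sym T (s1 * s2) * in_base (permute_coords f1 s2 * f2).
Proof.
rewrite in_symM in_baseM -!mulgA; congr (_ * _).
by rewrite !mulgA base_symC.
Qed.

Lemma wreath_inj f1 f2 s1 s2 :
  in_base f1 * in_sym T s1 = in_base f2 * in_sym T s2 -> f1 = f2 /\ s1 = s2.
Proof.
move/(congr1 (mulg (in_sym T s1)^-1)) => E0.
have: in_sym T s1 * in_base (permute_coords f1 s1)
    = in_sym T s2 * in_base (permute_coords f2 s2).
  by rewrite -!base_symC; apply: mulgI E0.
move=> E; have:= congr1 (fun x : wreath T n => x.1) E.
rewrite !wreath_fst => Es; split=> //.
have:= congr1 (fun x : wreath T n => x.2) E.
rewrite !wreath_snd Es => /ffunP Ef.
by apply/ffunP=> i; have := Ef (s2 i); rewrite !ffunE !permK.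
Qed.

(** Gathering the base component into a single function lets equalities of
    points be compared coordinatewise. *)
Lemma wtransE t i j :
  wtrans t i j = in_base (Defs.coord i t * Defs.coord j t^-1) * in_sym T (tperm i j).
Proof.
rewrite /wtrans in_baseM -in_baseV; congr (_ * _ * _); congr in_base.
by apply/ffunP=> l; rewrite !ffunE; case: ifP; rewrite ?invg1.
Qed.

Lemma wtransC t i j : i != j -> wtrans t i j = wtrans t^-1 j i.
Proof.
move=> ij; rewrite !wtransE invgK tpermC; congr (in_base _ * _).
apply/ffunP=> l; rewrite !ffunE.
case: (eqVneq l i) => [->|]; case: (eqVneq _ j) => // *; rewrite ?mulg1 ?mul1g //.
by case/eqP: ij.
Qed.

Lemma tperm_eq i j i' j' : i != j -> tperm i j = tperm i' j' ->
  (i' = i /\ j' = j) \/ (i' = j /\ j' = i).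
Proof.
move=> ij E; have:= congr1 (fun s : 'S_n => s i) E; rewrite tpermL.
case: tpermP => [-> ->|-> ->|_ _ ji]; [by left|by right|].
by rewrite ji eqxx in ij.
Qed.

(** The permutation parts give {i,j} = {i',j'}; comparing the
    base parts at i then gives h = g or h = g^-1. *)
Lemma wtrans_inj g h i j i' j' : i != j -> i' != j' ->
    wtrans g i j = wtrans h i' j' ->
  [/\ h = g, i' = i & j' = j] \/ [/\ h = g^-1, i' = j & j' = i].
Proof.
move=> ij ij'; rewrite !wtransE => /wreath_inj[/ffunP/(_ i) Ef /(tperm_eq ij)].
case=> -[Ei Ej]; subst i' j'; move: Ef; rewrite !ffunE eqxx (negPf ij).
  by rewrite !mulg1 => ->; left.
by rewrite mulg1 mul1g => ->; right; rewrite invgK.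
Qed.

Lemma wtrans_in t i j : i != j -> wtrans t i j \in wr_class T n.
Proof. by move=> ij; apply/wr_class_wtrans; exists t, i, j. Qed.

Lemma wtrans_point t i j : i != j ->
  exists c : point (wr_class T n), val c = wtrans t i j.
Proof.
by move=> ij; exists (exist (fun c => c \in wr_class T n) _ (wtrans_in t ij)).
Qed.

Lemma wtransJ_sym t i j s :
  wtrans t i j ^ in_sym T s = wtrans t (s i) (s j).
Proof.
rewrite !wtransE conjMg in_baseJ; congr (in_base _ * _); last first.
  by rewrite /conjg -!in_symM -tpermJ -(morphV (sdpair2_morphism _)) ?inE // -!in_symM.
by apply/ffunP=> l; rewrite !ffunE -!(canF_eq (permKV s)).
Qed.

Lemma in_sym_tperm_sq i j : in_sym T (tperm i j) * in_sym T (tperm i j) = 1.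
Proof. by rewrite -in_symM tperm2 in_sym1. Qed.

(** The transpositions cancel, so the exponent of T bounds the order of the
    product. *)
Lemma wtrans_mul g h i j : exists f, wtrans g i j * wtrans h i j = in_base f.
Proof.
rewrite !wtransE [in_base (Defs.coord i h * _) * _]base_symC mulgA.
rewrite -(mulgA (in_base _) (in_sym T _)) in_sym_tperm_sq mulg1 -in_baseM.
by eexists.
Qed.

Lemma wtransV t i j : i != j -> (wtrans t i j)^-1 = wtrans t i j.
Proof.
move=> ij; rewrite wtransE invMg -in_baseV.
have ->: (in_sym T (tperm i j))^-1 = in_sym T (tperm i j).
  by apply/eqP; rewrite eq_invg_mul in_sym_tperm_sq.
rewrite [RHS]base_symC; congr (_ * in_base _).
apply/ffunP=> l; rewrite !ffunE tpermV.
have ji : (j == i) = false by rewrite eq_sym (negPf ij).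
case: tpermP => [->|->|].
- by rewrite !eqxx ji (negPf ij) mulg1 mul1g.
- by rewrite !eqxx ji (negPf ij) mulg1 mul1g invgK.
- by move=> /eqP/negPf -> /eqP/negPf ->; rewrite mulg1 invg1.
Qed.

Lemma wtrans_order3 g h i j : (forall x : T, x ^+ 3 = 1) -> i != j ->
  wtrans g i j != wtrans h i j -> #[wtrans g i j * wtrans h i j] = 3.
Proof.
move=> T3 ij gh; apply: nt_prime_order => //.
  have [f ->] := wtrans_mul g h i j.
  rewrite -in_baseX -in_base1; congr in_base; apply/ffunP=> l.
  by rewrite base_groupX T3 ffunE.
by rewrite -eq_invg_mul wtransV.
Qed.

Lemma commute_coord i j g h : i != j ->
  commute (in_base (Defs.coord i g)) (in_base (Defs.coord j h)).
Proof.
move=> ij; rewrite /commute -!in_baseM; congr in_base; apply/ffunP=> l.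
rewrite !ffunE; case: (eqVneq l i) => [->|]; rewrite ?(negPf ij) ?mulg1 ?mul1g //.
Qed.

Lemma commute_coord_sym l g i j : l != i -> l != j ->
  commute (in_base (Defs.coord l g)) (in_sym T (tperm i j)).
Proof.
move=> li lj; apply/commgP/conjg_fixP; rewrite in_baseJ; congr in_base.
apply/ffunP=> m; rewrite !ffunE tpermV.
move: li lj; rewrite ![l == _]eq_sym => /negPf li /negPf lj.
by case: tpermP => [->|->|] //; rewrite li lj.
Qed.

Lemma wtrans_commute g h i j i' j' :
    [/\ i != i', i != j', j != i' & j != j'] ->
  commute (wtrans g i j) (wtrans h i' j').
Proof.
case=> ii' ij' ji' jj'.
have V x y : commute x y -> commute x y^-1 := @commuteV _ x y.
have aux y : commute (in_base (Defs.coord i g)) y ->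
    commute (in_base (Defs.coord j g)) y ->
    commute (in_sym T (tperm i j)) y -> commute (wtrans g i j) y.
  move=> /commute_sym ci /commute_sym cj /commute_sym cs; apply: commute_sym.
  by apply: commuteM => //; apply: commuteM => //; apply: V.
apply: aux; do ?apply: commuteM; do ?apply: V;
  do ?[exact: commute_coord | exact: commute_coord_sym
      | by apply/commute_sym/commute_coord_sym; rewrite eq_sym].
have C : commute (tperm i j) (tperm i' j').
  by apply/commgP/conjg_fixP; rewrite tpermJ !tpermD // eq_sym.
by rewrite /commute -!in_symM C.
Qed.

Lemma wtrans_disjoint_order g h i j i' j' : i != j -> i' != j' ->
    [/\ i != i', i != j', j != i' & j != j'] ->
  #[wtrans g i j * wtrans h i' j'] != 3.
Proof.
move=> ij ij' D; apply/eqP=> o3; have:= wtrans_commute g h D.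
set x := wtrans _ _ _ in o3 *; set y := wtrans _ _ _ in o3 *.
move=> C; have: (x * y) ^+ 2 = 1.
  by rewrite expgMn // expgS expg1 -{1}[x]wtransV ?mulVg // expgS expg1
             -{1}[y]wtransV ?mulVg // mulg1.
by move/eqP; rewrite -order_dvdn o3.
Qed.

End WreathFacts.

(** * The action of an automorphism of T on the coordinates *)

Section CoordwiseMap.

Variables (T : finGroupType) (n : nat) (sigma : {perm T}).
Hypothesis sigma_aut : sigma \in Aut [set: T].

Lemma autM : {morph sigma : x y / x * y}.
Proof.
by move=> x y; have:= morphicP (Aut_morphic sigma_aut) x y; apply; rewrite inE.
Qed.

Lemma aut1 : sigma 1 = 1.
Proof. by apply: (mulgI (sigma 1)); rewrite -autM !mulg1. Qed.

Lemma autV : {morph sigma : x / x^-1}.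
Proof. by move=> x; apply: (mulgI (sigma x)); rewrite -autM !mulgV aut1. Qed.

Lemma autX m : {morph sigma : x / x ^+ m}.
Proof. by move=> x; elim: m => [|m IHm]; rewrite ?aut1 // !expgS autM IHm. Qed.

Definition coordwise (x : wreath T n) : wreath T n :=
  in_sym T x.1 * in_base [ffun i => sigma (x.2 i)].

Lemma coordwiseE (s : 'S_n) (f : base_group T n) :
  coordwise (in_sym T s * in_base f) = in_sym T s * in_base [ffun i => sigma (f i)].
Proof. by rewrite /coordwise wreath_fst wreath_snd. Qed.

Lemma coordwiseM : {morph coordwise : x y / x * y}.
Proof.
move=> x y; rewrite [x]sdpairE [y]sdpairE -/(in_sym T _) -/(in_sym T _).
rewrite -/(in_base _) -/(in_base _); move: x.1 x.2 y.1 y.2 => s f t g.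
rewrite wreath_mul !coordwiseE wreath_mul; congr (_ * in_base _).
by apply/ffunP=> i; rewrite !ffunE autM.
Qed.

Lemma coordwise_inj : injective coordwise.
Proof.
move=> x y; rewrite [x]sdpairE [y]sdpairE -/(in_sym T _) -/(in_sym T _).
rewrite -/(in_base _) -/(in_base _); move: x.1 x.2 y.1 y.2 => s f t g.
rewrite !coordwiseE => E.
have:= congr1 (fun x : wreath T n => x.1) E.
have:= congr1 (fun x : wreath T n => x.2) E.
rewrite !wreath_fst !wreath_snd => /ffunP Ef ->; congr (_ * in_base _).
by apply/ffunP=> i; have:= Ef i; rewrite !ffunE => /perm_inj.
Qed.

Lemma coordwise_wtrans t i j : coordwise (wtrans t i j) = wtrans (sigma t) i j.
Proof.
rewrite !wtransE !base_symC coordwiseE; congr (_ * in_base _).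
apply/ffunP=> l; rewrite !ffunE autM.
by do 2!case: ifP => _; rewrite ?autV ?aut1.
Qed.

End CoordwiseMap.

(** * The pairing permutation *)

Section PairingFacts.

(** The two values must be proved together: after the factor of index i has
    moved a i to b i, the remaining factors act on b i. *)
Lemma prod_tperm (I : eqType) (X : finType) (a b : I -> X) (s : seq I) :
    injective a -> injective b -> (forall i j, a i != b j) -> uniq s ->
  forall j, ((\prod_(i <- s) tperm (a i) (b i)) (a j)
               = if j \in s then b j else a j) /\
            ((\prod_(i <- s) tperm (a i) (b i)) (b j)
               = if j \in s then a j else b j).
Proof.
move=> ia ib ab; elim: s => [|i s IHs] /= => [_ j|/andP[nsi us] j].
  by rewrite big_nil !perm1.
have [IHa IHb] := IHs us j; rewrite big_cons !permM inE.
case: (eqVneq j i) => [->|ji] /=.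
  by have [{}IHa {}IHb] := IHs us i; rewrite tpermL tpermR IHa IHb (negPf nsi).
by rewrite !tpermD ?(inj_eq ia) ?(inj_eq ib) ?ab // eq_sym ?ab.
Qed.

Variable k : nat.
Implicit Types (i : 'I_k) (j l : 'I_(2 * k)%N).

Lemma odd_idx_inj : injective (@odd_idx k).
Proof.
by move=> i i' /(congr1 val)/= /eqP; rewrite eqn_pmul2l // => /eqP/val_inj.
Qed.

Lemma even_idx_inj : injective (@even_idx k).
Proof.
by move=> i i' /(congr1 val)/= [] /eqP; rewrite eqn_pmul2l // => /eqP/val_inj.
Qed.

Lemma odd_even_neq i i' : odd_idx i != even_idx i'.
Proof.
apply/eqP => /(congr1 (fun j => odd (val j))) /=.
by rewrite !oddM.
Qed.

Lemma pairing_odd i : pairing k (odd_idx i) = even_idx i.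
Proof.
have [-> _] := prod_tperm odd_idx_inj even_idx_inj odd_even_neq
                 (index_enum_uniq 'I_k) i.
by rewrite mem_index_enum.
Qed.

Lemma pairing_even i : pairing k (even_idx i) = odd_idx i.
Proof.
have [_ ->] := prod_tperm odd_idx_inj even_idx_inj odd_even_neq
                 (index_enum_uniq 'I_k) i.
by rewrite mem_index_enum.
Qed.

Lemma idx_cases j : exists i, j = odd_idx i \/ j = even_idx i.
Proof.
have lt_j : (j./2 < k)%N by rewrite ltn_half_double -mul2n.
exists (Ordinal lt_j); have := odd_double_half j.
case: (odd j) => /= E; [right|left]; apply: val_inj => /=.
  by rewrite [in RHS]mul2n; apply: esym.
by rewrite [in RHS]mul2n; apply: esym.
Qed.

Lemma pairingK : involutive (pairing k).
Proof.
by move=> j; have [i [->|->]] := idx_cases j; rewrite !(pairing_odd, pairing_even).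
Qed.

Lemma pairing_neq j : pairing k j != j.
Proof.
have [i [->|->]] := idx_cases j; rewrite !(pairing_odd, pairing_even).
  by rewrite eq_sym odd_even_neq.
by rewrite odd_even_neq.
Qed.

(** Each of the 2k indices excludes itself and its partner. *)
Lemma card_unmatched :
  #|[set ij : 'I_(2 * k) * 'I_(2 * k) | (ij.1 != ij.2) && (pairing k ij.1 != ij.2)]|
    = (4 * k * (k - 1))%N.
Proof.
transitivity (\sum_(i : 'I_(2 * k)) \sum_(j | (i != j) && (pairing k i != j)) 1)%N.
  by rewrite pair_big_dep sum1dep_card.
have E (i : 'I_(2 * k)) : (\sum_(j | (i != j) && (pairing k i != j)) 1
             = 2 * (k - 1))%N.
  rewrite sum1dep_card.
  have -> : [set j | (i != j) && (pairing k i != j)] = ~: [set i; pairing k i].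
    by apply/setP=> j; rewrite !inE negb_or ![j == _]eq_sym.
  by rewrite cardsCs setCK cards2 [i == _]eq_sym pairing_neq card_ord mulnBr.
rewrite (eq_bigr _ (fun l _ => E l)) sum_nat_const card_ord.
by rewrite mulnACA mulnA.
Qed.

End PairingFacts.

(** * Existence and uniqueness of the flip *)

Section InducedAutomorphism.

Variables (gT : finGroupType) (D : {set gT}) (f : {morphism [set: gT] >-> gT}).
Hypotheses (injf : 'injm f) (fD : forall c, c \in D -> f c \in D).

Definition point_map (c : point D) : point D := Sub (f (val c)) (fD (valP c)).

Lemma point_map_inj : injective point_map.
Proof.
move=> c d /(congr1 val) /=.
by move/(injmP injf) => E; apply: val_inj; apply: E; rewrite inE.
Qed.

(** Lines are described by orders of products and by conjugates, both of which
    an injective endomorphism respects; being a permutation of the finite set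
    of points, the induced map also reflects lines. *)
Lemma induced_fischer_aut : fischer_aut (perm point_map_inj).
Proof.
set h := perm _.
have hE c : val (h c) = f (val c) by rewrite permE.
pose line (c d : point D) :=
  [set z : point D | val z \in [set val c; val d; val c ^ val d]].
have h_line c d : h @: line c d = line (h c) (h d).
  apply/setP=> z; rewrite -[z](permKV h) mem_imset; last exact: perm_inj.
  rewrite !inE !hE -morphJ ?inE //.
  by rewrite !(inj_in_eq (injmP injf)) ?inE.
have h_order c d : #[val (h c) * val (h d)] = #[val c * val d].
  by rewrite !hE -morphM ?inE // order_injm ?inE.
move=> L; rewrite !inE; apply/existsP/existsP => -[c /existsP[d /andP[o3 /eqP E]]].
  exists (h^-1 c); apply/existsP; exists (h^-1 d).
  rewrite -h_order !permKV o3 -/(line _ _) /=; apply/eqP.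
  by apply: (imset_inj (@perm_inj _ h)); rewrite h_line !permKV.
exists (h c); apply/existsP; exists (h d).
by rewrite h_order o3 E -/(line _ _) -/(line _ _) h_line eqxx.
Qed.

End InducedAutomorphism.

Section FlipExists.

Variables (T : finGroupType) (sigma : {perm T}) (k : nat).
Hypothesis sigma_aut : sigma \in Aut [set: T].

Definition flip_wreath (x : wreath T (2 * k)) : wreath T (2 * k) :=
  coordwise sigma x ^ in_sym T (pairing k).

Lemma flip_wreathM : {in [set: wreath T (2 * k)] &, {morph flip_wreath : x y / x * y}}.
Proof. by move=> x y _ _; rewrite /flip_wreath coordwiseM // conjMg. Qed.

Canonical flip_wreath_morphism := Morphism flip_wreathM.

Lemma injm_flip_wreath : 'injm flip_wreath.
Proof. by apply/injmP=> x y _ _ /conjg_inj; apply: coordwise_inj. Qed.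

Lemma flip_wreath_wtrans g i j :
  flip_wreath (wtrans g i j) = wtrans (sigma g) (pairing k i) (pairing k j).
Proof. by rewrite /flip_wreath coordwise_wtrans // wtransJ_sym. Qed.

Lemma flip_wreath_class x :
  x \in wr_class T (2 * k) -> flip_wreath x \in wr_class T (2 * k).
Proof.
case/wr_class_wtrans=> g [i [j ij ->]]; rewrite flip_wreath_wtrans.
by apply: wtrans_in; rewrite (inj_eq perm_inj).
Qed.

(** Uniqueness holds because every point is some wtrans g i j, whose image is
    prescribed. *)
Lemma flip_aut_exists_unique : exists! tau, @flip_aut T sigma k tau.
Proof.
exists (perm (@point_map_inj _ _ _ injm_flip_wreath flip_wreath_class)); split.
  split=> [|c g i j ij Ec]; first exact: induced_fischer_aut.
  by rewrite permE /= Ec flip_wreath_wtrans.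
move=> tau [_ Htau]; apply/permP=> c; apply: val_inj; rewrite permE /=.
have /wr_class_wtrans[g [i [j ij Ec]]] := valP c.
by rewrite (Htau c g i j ij Ec) Ec flip_wreath_wtrans.
Qed.

End FlipExists.

(** * Orbit vectors and the fixed subspace *)

(** Used twice: for the two names g.(i,j) and g^-1.(j,i) of a point, and for the
    two points of an orbit. *)
Lemma card_two_to_one (X Y : finType) (f : X -> Y) (t : X -> X) (A : {set X}) :
    (forall x, x \in A -> t x \in A /\ t x != x) ->
    {in A &, forall x y, f x = f y <-> y = x \/ y = t x} ->
  (#|f @: A| * 2 = #|A|)%N.
Proof.
move=> tA fA; rewrite -[RHS]sum1_card (partition_big_imset f) /=.
rewrite (eq_bigr (fun _ => 2)) => [|_ /imsetP[x Ax ->]]; last first.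
  have [Atx tx] := tA x Ax; rewrite sum1dep_card.
  rewrite -[RHS](_ : #|[set x; t x]| = 2); last by rewrite cards2 eq_sym tx.
  apply: eq_card => y; rewrite !inE; apply/andP/pred2P => [[Ay /eqP E]|].
    by apply/(fA x y).
  move=> E; have Ay : y \in A by case: E => ->.
  by split=> //; apply/eqP/esym/(fA x y).
by rewrite sum_nat_const.
Qed.

Section MatsuoFacts.

Variables (gT : finGroupType) (D : {set gT}) (F : fieldType).
Implicit Types (a b c : point D) (A : {set point D}).

Local Notation vec c := (bvec D F (val c)).

Definition orbit_vec A : matsuo D F := (\sum_(c in A) vec c)%R.

Lemma bvecE a b : vec a b = ((b == a)%:R)%R.
Proof. by rewrite ffunE (inj_eq val_inj). Qed.

Lemma orbit_vecE A b : orbit_vec A b = ((b \in A)%:R)%R.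
Proof.
rewrite /orbit_vec sum_ffunE; case: (boolP (b \in A)) => bA.
  rewrite (bigD1 b) //= bvecE eqxx big1 ?addr0 // => c /andP[_ cb].
  by rewrite bvecE eq_sym (negPf cb).
by rewrite big1 // => c cA; rewrite bvecE; case: eqP => // E; rewrite E cA in bA.
Qed.

Lemma scale_orbit_vecE (z : F) A b :
  (z *: orbit_vec A)%R b = if b \in A then z else 0%R.
Proof.
rewrite ffunE orbit_vecE; case: (b \in A); [exact: mulr1 | exact: mulr0].
Qed.

Lemma natr_bool_inj : injective (fun b : bool => (b%:R : F)%R).
Proof.
by case=> [] [] // /eqP; rewrite ?[0%R == _]eq_sym oner_eq0.
Qed.

Lemma orbit_vec_inj : injective orbit_vec.
Proof.
move=> A B /ffunP E; apply/setP=> c; apply: natr_bool_inj.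
by have:= E c; rewrite !orbit_vecE.
Qed.

Lemma orbit_vec1 a : orbit_vec [set a] = vec a.
Proof. by rewrite /orbit_vec big_set1. Qed.

Lemma orbit_vec2 a b : a != b -> orbit_vec [set a; b] = (vec a + vec b)%R.
Proof. by move=> ab; rewrite /orbit_vec big_setU1 ?inE //= big_set1. Qed.

(** The ambient space may be infinite, so vectors are counted through the
    finitely many sets of points that they come from. *)
Lemma has_card_orbit_vec (Q : matsuo D F -> Prop) (W : {set {set point D}}) n :
    #|W| = n -> (forall x, Q x <-> exists2 A, A \in W & x = orbit_vec A) ->
  has_card Q n.
Proof.
move=> <- QW; exists [seq orbit_vec A | A <- enum W]; split.
- by rewrite (map_inj_uniq orbit_vec_inj) enum_uniq.
- by rewrite size_map cardE.
- move=> x; split=> [/mapP[A]|/QW[A AW ->]].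
    by rewrite mem_enum => AW ->; apply/QW; exists A.
  by apply/mapP; exists A; rewrite ?mem_enum.
Qed.

(** The coordinates of a fixed vector are constant on orbits, so it is the
    combination of the orbit vectors with these constants as coefficients.
    The orbit vectors are independent as their supports are disjoint. *)
Lemma dim_fixed_subalg (G : {group {perm point D}}) :
  \dim (fixed_subalg F G) = #|orbit 'P G @: [set: point D]|.
Proof.
set W := _ @: _.
have memW a : orbit 'P G a \in W by rewrite imset_f ?inE.
have in_orbit A a : A \in W -> (a \in A) = (A == orbit 'P G a).
  by case/imsetP=> b _ ->; apply/idP/eqP => [/orbit_eqP//|->]; rewrite orbit_refl.
pose X := [seq orbit_vec A | A <- enum W].
have -> : fixed_subalg F G = <<X>>%VS.
  apply/eqP; rewrite eqEsubv; apply/andP; split; last first.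
    apply/span_subvP=> x /mapP[A]; rewrite mem_enum => AW ->.
    apply/fixed_subalgP=> h Gh; apply/ffunP=> c; rewrite ffunE !orbit_vecE.
    by rewrite !in_orbit // -(orbit_act 'P c (groupVr Gh)).
  apply/subvP=> x /fixed_subalgP fix_x.
  (* The value of x on the set A; the default 0 is never reached on orbits. *)
  pose y A := if [pick a in A] is Some a then x a else 0%R.
  have -> : x = (\sum_(A in W) y A *: orbit_vec A)%R.
    apply/ffunP=> b; rewrite sum_ffunE (bigD1 _ (memW b)) /= big1 ?addr0.
      rewrite scale_orbit_vecE orbit_refl /y.
      case: pickP => [a|/(_ b)]; last by rewrite orbit_refl.
      case/orbitP=> h Gh <-.
      by have /ffunP/(_ (h b)) := fix_x h Gh; rewrite ffunE permK.
    move=> A /andP[AW neA]; rewrite scale_orbit_vecE in_orbit //.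
    by rewrite (negPf neA).
  apply: rpred_sum => A AW; apply: rpredZ; apply: memv_span.
  by apply: map_f; rewrite mem_enum.
rewrite (_ : \dim _ = size X); first by rewrite size_map cardE.
apply/eqP; rewrite -/(free X).
pose Xt := [tuple of map orbit_vec (enum_tuple W)].
rewrite (_ : X = Xt) //; apply/freeP=> y y0 i.
have AW : tnth (enum_tuple W) i \in W by rewrite -mem_enum mem_tnth.
have [b _ Ab] := imsetP AW.
have /ffunP/(_ b) := y0; rewrite sum_ffunE (bigD1 i) //= big1 => [|l li].
  by rewrite addr0 -tnth_nth tnth_map scale_orbit_vecE Ab orbit_refl ffunE.
have lW : tnth (enum_tuple W) l \in W by rewrite -mem_enum mem_tnth.
rewrite -tnth_nth tnth_map scale_orbit_vecE in_orbit // -Ab.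
rewrite ifN // !(tnth_nth set0) nth_uniq ?enum_uniq //.
all: by rewrite -cardE.
Qed.

End MatsuoFacts.

(** * Singles, doubles and extras of an involution *)

Section Involution.

Variables (gT : finGroupType) (D : {set gT}) (F : fieldType) (eta : F).
Hypotheses (hchar : 2%N \notin [pchar F]%R) (heta0 : eta != 0%R).
Implicit Types (a b c : point D).

Local Notation vec c := (bvec D F (val c)).

Lemma matsuo_mul_bvec a b :
  matsuo_mul eta (vec a) (vec b) = basis_mul D eta (val a) (val b).
Proof.
rewrite /matsuo_mul (bigD1 a) //= (bigD1 b) //= !bvecE !eqxx mulr1 scale1r.
rewrite !big1 ?addr0 // => [c ca | c cb].
  by rewrite big1 // => d _; rewrite bvecE (negPf ca) mul0r scale0r.
by rewrite [vec b c]bvecE (negPf cb) mulr0 scale0r.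
Qed.

(** If |ab| = 3, then a + b - a^b has coefficient 1 at b, as b = a^b would
    force a = b; the factor eta / 2 is nonzero. *)
Lemma matsuo_mul_bvec_eq0 a b : a != b ->
  matsuo_mul eta (vec a) (vec b) = 0%R <-> #[val a * val b] != 3.
Proof.
move=> ab; rewrite matsuo_mul_bvec /basis_mul (inj_eq val_inj) (negPf ab).
case: eqP => [o3|_]; last by split.
split=> // /eqP; rewrite scaler_eq0 mulf_eq0 (negPf heta0) invr_eq0 /=.
have -> : (2%:R == 0 :> F)%R = false.
  by apply/negP=> two0; case/negP: hchar; rewrite inE /= two0.
move/eqP/ffunP/(_ b); rewrite !ffunE (inj_eq val_inj) eqxx [b == a]eq_sym (negPf ab).
have /negPf -> : val b != val a ^ val b.
  have {1}<- : val b ^ val b = val b by rewrite conjgE mulKg.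
  rewrite (inj_eq (@conjg_inj _ _)).
  by rewrite (inj_eq val_inj) eq_sym.
by rewrite subr0 add0r => /eqP; rewrite oner_eq0.
Qed.

Variable tau : {perm point D}.
Hypothesis tauK : involutive tau.

Local Notation H := <[tau]>.

Lemma cycle_involution : H = [set 1; tau].
Proof.
have t2 : tau ^+ 2 = 1 by apply/permP=> c; rewrite expgS expg1 permM perm1 tauK.
apply/eqP; rewrite eqEsubset; apply/andP; split.
  apply/subsetP=> _ /cycleP[m ->]; rewrite -(expg_mod m t2) !inE modn2.
  by case: (odd m); rewrite ?expg0 ?expg1 eqxx ?orbT.
by apply/subsetP=> h /set2P[] ->; rewrite ?group1 ?cycle_id.
Qed.

Lemma orbit_involution a : orbit 'P H a = [set a; tau a].
Proof.
rewrite /orbit cycle_involution; apply/setP=> b; rewrite !inE.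
apply/imsetP/pred2P => [[h /set2P[] -> ->]|[]->].
- by left; rewrite act1.
- by right.
- by exists 1; rewrite ?inE ?eqxx ?act1.
- by exists tau; rewrite ?inE ?eqxx ?orbT.
Qed.

Lemma is_orbit_vecE x : is_orbit_vec H x <-> exists a, x = orbit_vec F [set a; tau a].
Proof.
by split=> -[a ->]; exists a; rewrite orbit_involution.
Qed.

Lemma set2_eqP (X : finType) (t : X -> X) (x y : X) : involutive t ->
  [set x; t x] = [set y; t y] <-> y = x \/ y = t x.
Proof.
move=> tK; split=> [/setP /(_ y)|[->//|->]].
  by rewrite !inE eqxx /= => /pred2P.
by rewrite tK; apply: setUC.
Qed.

Lemma is_singleP (x : matsuo D F) : is_single H x <->
  exists2 a, tau a = a & x = vec a.
Proof.
split=> [[_ [a Ea ->]]|[a ta ->]].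
  exists a => //; apply/set1P; rewrite -Ea orbit_involution !inE eqxx orbT //.
have Ea : orbit 'P H a = [set a] by rewrite orbit_involution ta setUid.
by split; [exists a; rewrite Ea big_set1 | exists a].
Qed.

Lemma orbit_pair a b : a != b -> orbit 'P H a = [set a; b] -> b = tau a.
Proof.
rewrite orbit_involution => ab /setP/(_ b); rewrite !inE eqxx orbT eq_sym (negPf ab).
by move/eqP.
Qed.

Lemma is_doubleP (x : matsuo D F) : is_double eta H x <->
  exists a, [/\ tau a != a, #[val a * val (tau a)] != 3 & x = (vec a + vec (tau a))%R].
Proof.
split=> [[_ [a [b [ab Eo m0 ->]]]]|[a [ta o3 ->]]].
  have Eb := orbit_pair ab Eo; subst b; exists a; split=> //; first by rewrite eq_sym.
  by apply/matsuo_mul_bvec_eq0.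
rewrite eq_sym in ta; split; first by apply/is_orbit_vecE; exists a; rewrite orbit_vec2.
by exists a, (tau a); rewrite orbit_involution; split=> //; apply/matsuo_mul_bvec_eq0.
Qed.

Lemma is_extraP (x : matsuo D F) : is_extra eta H x <->
  exists a, [/\ tau a != a, #[val a * val (tau a)] = 3 & x = (vec a + vec (tau a))%R].
Proof.
split=> [[_ [a [b [ab Eo m0 ->]]]]|[a [ta o3 ->]]].
  have Eb := orbit_pair ab Eo; subst b; exists a; split=> //; first by rewrite eq_sym.
  by apply/eqP; apply/negPn/negP => /(matsuo_mul_bvec_eq0 ab).
rewrite eq_sym in ta; split; first by apply/is_orbit_vecE; exists a; rewrite orbit_vec2.
exists a, (tau a); rewrite orbit_involution; split=> //.
by move/matsuo_mul_bvec_eq0; rewrite o3 ta => /(_ isT).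
Qed.

Lemma has_card_fixed (Q : matsuo D F -> Prop) :
    (forall x, Q x <-> exists2 a, tau a = a & x = vec a) ->
  has_card Q #|[set c | tau c == c]|.
Proof.
move=> QP; apply: (@has_card_orbit_vec _ _ _ _
  [set [set c] | c in [set c | tau c == c]]).
  by rewrite card_imset //; apply: set1_inj.
move=> x; apply: (iff_trans (QP x)); split=> [[a ta ->]|[_ /imsetP[a ta ->] ->]].
  by exists [set a]; rewrite ?orbit_vec1 // imset_f // inE ta.
by exists a; rewrite ?orbit_vec1 //; apply/eqP; rewrite inE in ta.
Qed.

Lemma has_card_moved (Q : matsuo D F -> Prop) (A : {set point D}) n :
    (forall a, a \in A -> tau a \in A /\ tau a != a) ->
    #|A| = (n * 2)%N ->
    (forall x, Q x <-> exists2 a, a \in A & x = (vec a + vec (tau a))%R) ->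
  has_card Q n.
Proof.
move=> tA An QP; apply: (@has_card_orbit_vec _ _ _ _ [set [set a; tau a] | a in A]).
  apply/eqP; rewrite -(eqn_pmul2r (isT : 0 < 2)%N) -An; apply/eqP.
  by apply: (card_two_to_one tA) => a b _ _; apply: set2_eqP.
move=> x; apply: (iff_trans (QP x)); split=> [[a Aa ->]|[_ /imsetP[a Aa ->] ->]].
  exists [set a; tau a]; first exact: imset_f.
  by rewrite orbit_vec2 // eq_sym; case: (tA a Aa).
by exists a => //; rewrite orbit_vec2 // eq_sym; case: (tA a Aa).
Qed.

(** The orbit-counting lemma for the group {1, tau}. *)
Lemma dim_fixed_involution : tau != 1 ->
  (\dim (fixed_subalg F H) * 2 = #|[set: point D]| + #|[set c | tau c == c]|)%N.
Proof.
move=> t1; rewrite dim_fixed_subalg.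
have o2 : #|H| = 2 by rewrite cycle_involution cards2 eq_sym t1.
have acts_all : [acts H, on [set: point D] | 'P].
  by apply/actsP=> h _ c; rewrite !inE.
have := Frobenius_Cauchy acts_all; rewrite /= o2 => <-.
rewrite cycle_involution big_setU1 ?inE 1?eq_sym //= big_set1.
congr (_ + _)%N; apply: eq_card => c; rewrite !inE /=.
  by rewrite sub1set inE apermE perm1 eqxx.
by rewrite sub1set inE.
Qed.

End Involution.

(** * The orbits of the flip *)

Section FlipOrbits.

Variables (T : finGroupType) (sigma : {perm T}) (k : nat).
Hypotheses (T3 : forall x : T, x ^+ 3 = 1) (sigma_aut : sigma \in Aut [set: T]).
Hypothesis sigmaK : involutive sigma.

Local Notation D := (wr_class T (2 * k)).

Variable tau : {perm point D}.
Hypothesis tau_flip : flip_aut sigma tau.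
Implicit Types (c : point D) (g : T) (i : 'I_k) (j l : 'I_(2 * k)).

(** These elements parametrize the fixed points: see flip_fixedP. *)
Definition inverted : {set T} := [set g | sigma g == g^-1].

Lemma flipK : involutive tau.
Proof.
case: tau_flip => _ Htau c; have /wr_class_wtrans[g [i [j ij Ec]]] := valP c.
apply: val_inj; have Et := Htau c g i j ij Ec.
rewrite (Htau _ _ _ _ _ Et) ?(inj_eq perm_inj) //.
by rewrite sigmaK !pairingK Ec.
Qed.

(** The flip interchanges the indices 2i-1 and 2i; restoring their order
    inverts the group element. *)
Lemma flip_matched c g i : val c = wtrans g (odd_idx i) (even_idx i) ->
  val (tau c) = wtrans (sigma g)^-1 (odd_idx i) (even_idx i).
Proof.
case: tau_flip => _ Htau Ec; rewrite (Htau c g _ _ (odd_even_neq i i) Ec).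
by rewrite pairing_odd pairing_even wtransC // eq_sym odd_even_neq.
Qed.

Lemma flip_unmatched c g j l : j != l -> val c = wtrans g j l ->
  val (tau c) = wtrans (sigma g) (pairing k j) (pairing k l).
Proof. by case: tau_flip => _; apply. Qed.

Lemma wtrans_matched_inj g h i i' :
    wtrans g (odd_idx i) (even_idx i) = wtrans h (odd_idx i') (even_idx i') ->
  g = h /\ i = i'.
Proof.
move=> E; have [] := wtrans_inj (odd_even_neq i i) (odd_even_neq i' i') E.
  by case=> -> /odd_idx_inj ->.
by case=> _ /eqP; rewrite (negPf (odd_even_neq _ _)).
Qed.

Lemma matched_fixed c g i : val c = wtrans g (odd_idx i) (even_idx i) ->
  (tau c == c) = (g \in inverted).
Proof.
move=> Ec; rewrite -val_eqE (flip_matched Ec) Ec inE; apply/eqP/eqP.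
  by case/wtrans_matched_inj=> E _; rewrite -[in RHS]E invgK.
by move=> ->; rewrite invgK.
Qed.

Lemma matched_order c g i : val c = wtrans g (odd_idx i) (even_idx i) ->
  g \notin inverted -> #[val c * val (tau c)] = 3.
Proof.
move=> Ec; rewrite -(matched_fixed Ec) eq_sym -val_eqE.
by rewrite (flip_matched Ec) Ec => /(wtrans_order3 T3 (odd_even_neq i i)).
Qed.

Lemma unmatched_disjoint j l : pairing k j != l ->
  [/\ j != pairing k j, j != pairing k l, l != pairing k j & l != pairing k l].
Proof.
move=> jl; rewrite ![_ == pairing k _]eq_sym !pairing_neq jl; split=> //.
by rewrite -(inj_eq (@perm_inj _ (pairing k))) pairingK eq_sym.
Qed.

Lemma unmatched_moved c g j l : j != l -> pairing k j != l ->
  val c = wtrans g j l -> tau c != c.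
Proof.
move=> jl pjl Ec; have [jj' jl' _ _] := unmatched_disjoint pjl.
apply/eqP => /(congr1 val); rewrite (flip_unmatched jl Ec) Ec.
move=> E; have pjl' : pairing k j != pairing k l by rewrite (inj_eq perm_inj).
have [[_ /eqP]|[_ /eqP]] := wtrans_inj pjl' jl E.
  by rewrite (negPf jj').
by rewrite (negPf jl').
Qed.

Lemma unmatched_order c g j l : j != l -> pairing k j != l ->
  val c = wtrans g j l -> #[val c * val (tau c)] != 3.
Proof.
move=> jl pjl Ec; rewrite (flip_unmatched jl Ec) Ec.
by apply: wtrans_disjoint_order (unmatched_disjoint pjl); rewrite ?(inj_eq perm_inj).
Qed.

Lemma point_cases c :
  (exists g i, val c = wtrans g (odd_idx i) (even_idx i)) \/
  (exists g j l, [/\ j != l, pairing k j != l & val c = wtrans g j l]).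
Proof.
have /wr_class_wtrans[g [j [l jl Ec]]] := valP c.
have [jl'|] := eqVneq (pairing k j) l; last by right; exists g, j, l.
left; have [i [Ej|Ej]] := idx_cases j.
  by exists g, i; rewrite Ec -jl' Ej pairing_odd.
exists g^-1, i; rewrite Ec wtransC // -jl' Ej pairing_even //.
Qed.

Lemma flip_fixedP c : tau c = c <->
  exists g i, g \in inverted /\ val c = wtrans g (odd_idx i) (even_idx i).
Proof.
split=> [tc|[g [i [ginv Ec]]]]; last by apply/eqP; rewrite (matched_fixed Ec).
have [[g [i Ec]]|[g [j [l [jl pjl Ec]]]]] := point_cases c.
  by exists g, i; rewrite -(matched_fixed Ec) tc eqxx.
by have:= unmatched_moved jl pjl Ec; rewrite tc eqxx.
Qed.

Lemma flip_extraP c : (tau c != c /\ #[val c * val (tau c)] = 3) <->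
  exists g i, g \notin inverted /\ val c = wtrans g (odd_idx i) (even_idx i).
Proof.
split=> [[tc o3]|[g [i [ginv Ec]]]]; last first.
  by rewrite (matched_fixed Ec) (matched_order Ec).
have [[g [i Ec]]|[g [j [l [jl pjl Ec]]]]] := point_cases c.
  by exists g, i; rewrite -(matched_fixed Ec).
by have:= unmatched_order jl pjl Ec; rewrite o3.
Qed.

Lemma flip_doubleP c : (tau c != c /\ #[val c * val (tau c)] != 3) <->
  exists g j l, [/\ j != l, pairing k j != l & val c = wtrans g j l].
Proof.
split=> [[tc o3]|[g [j [l [jl pjl Ec]]]]]; last first.
  by rewrite (unmatched_moved jl pjl Ec) (unmatched_order jl pjl Ec).
have [[g [i Ec]]|//] := point_cases c.
by rewrite (matched_order Ec) // -(matched_fixed Ec) in o3.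
Qed.

Lemma card_matched (A : {set T}) :
  #|[set c : point D | [exists g in A, [exists i : 'I_k,
      val c == wtrans g (odd_idx i) (even_idx i)]]]| = (#|A| * k)%N.
Proof.
pose f (gi : T * 'I_k) : wreath T (2 * k) := wtrans gi.1 (odd_idx gi.2) (even_idx gi.2).
have f_inj : injective f.
  by move=> [g i] [h i'] /wtrans_matched_inj /= [-> ->].
have -> : (#|A| * k)%N = #|f @: setX A [set: 'I_k]|.
  by rewrite card_imset // cardsX cardsT card_ord.
rewrite -(card_imset _ val_inj); apply: eq_card => x; apply/imsetP/imsetP.
  case=> c; rewrite inE => /exists_inP[g Ag /existsP[i /eqP Ec]] ->.
  by exists (g, i); rewrite ?inE ?Ag.
case=> -[g i]; rewrite !inE andbT /= => Ag ->.
have [c Ec] := wtrans_point g (odd_even_neq i i); exists c => //.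
rewrite inE; apply/exists_inP; exists g => //; apply/existsP; exists i.
exact/eqP.
Qed.

Definition single_points : {set point D} := [set c | tau c == c].
Definition extra_points : {set point D} :=
  [set c | (tau c != c) && (#[val c * val (tau c)] == 3)].
Definition double_points : {set point D} :=
  [set c | (tau c != c) && (#[val c * val (tau c)] != 3)].

Lemma card_single_points : #|single_points| = (#|inverted| * k)%N.
Proof.
rewrite -card_matched; apply: eq_card => c; rewrite !inE; apply/eqP/exists_inP.
  case/flip_fixedP=> g [i [Ag Ec]]; exists g => //; apply/existsP; exists i.
  exact/eqP.
by case=> g Ag /existsP[i /eqP Ec]; apply/flip_fixedP; exists g, i.
Qed.

Lemma card_extra_points : #|extra_points| = ((#|T| - #|inverted|) * k)%N.
Proof.
have -> : (#|T| - #|inverted|)%N = #|~: inverted| by rewrite [RHS]cardsCs setCK.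
rewrite -card_matched; apply: eq_card => c; rewrite !inE.
apply/andP/exists_inP => [[tc /eqP o3]|[g]].
  have /flip_extraP[g [i [Ag Ec]]] := conj tc o3.
  exists g; rewrite ?inE // in Ag *; apply/existsP; exists i; exact/eqP.
rewrite inE => Ag /existsP[i /eqP Ec].
have [|tc o3] := (flip_extraP c).2; first by exists g, i.
by rewrite tc o3.
Qed.

(** Each point has the two names g.(j,l) and g^-1.(l,j), so the triples
    (g,j,l) are twice as many as the points. *)
Lemma card_double_points :
  #|double_points| = (#|T| * (2 * k * (k - 1)))%N.
Proof.
pose f (x : T * ('I_(2 * k) * 'I_(2 * k))) : wreath T (2 * k) :=
  wtrans x.1 x.2.1 x.2.2.
pose rev (x : T * ('I_(2 * k) * 'I_(2 * k))) := (x.1^-1, (x.2.2, x.2.1)).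
pose U := [set ij : 'I_(2 * k) * 'I_(2 * k) |
            (ij.1 != ij.2) && (pairing k ij.1 != ij.2)].
pose Q := setX [set: T] U.
have revQ x : x \in Q -> rev x \in Q /\ rev x != x.
  case: x => g [j l]; rewrite /rev !inE /= => /andP[jl pjl].
  have [_ ? _ _] := unmatched_disjoint pjl.
  rewrite [l == j]eq_sym jl [_ == j]eq_sym; split=> //.
  by apply/eqP => -[_ /eqP]; rewrite eq_sym (negPf jl).
have fQ : {in Q &, forall x y, f x = f y <-> y = x \/ y = rev x}.
  move=> [g [j l]] [h [j' l']]; rewrite /f /rev !inE /=.
  move=> /andP[jl _] /andP[jl' _]; split=> [E|].
    by have [[-> -> ->]|[-> -> ->]] := wtrans_inj jl jl' E; [left|right].
  by case=> -[-> -> ->] //; apply: wtransC.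
have := card_two_to_one revQ fQ.
rewrite cardsX cardsT card_unmatched => E.
have -> : #|double_points| = #|f @: Q|.
  rewrite -(card_imset _ val_inj); apply: eq_card => x; apply/imsetP/imsetP.
    case=> c; rewrite inE => /andP[tc o3] ->.
    have /flip_doubleP[g [j [l [jl pjl Ec]]]] := conj tc o3.
    by exists (g, (j, l)); rewrite // !inE /= jl pjl.
  case=> -[g [j l]]; rewrite !inE /= => /andP[jl pjl] ->.
  have [c Ec] := wtrans_point g jl; exists c => //; rewrite inE.
  by have [|-> ->] := (flip_doubleP c).2; first by exists g, j, l.
apply/eqP; rewrite -(eqn_pmul2r (isT : 0 < 2)%N) E; apply/eqP.
by rewrite -[RHS]mulnA [(_ * 2)%N]mulnC ![(2 * (_ * _))%N]mulnA.
Qed.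

(** Fixed and extra points together are the matched points. *)
Lemma card_points : #|[set: point D]| = (#|T| * k + #|T| * (2 * k * (k - 1)))%N.
Proof.
rewrite -card_double_points.
have -> : (#|T| * k = #|single_points| + #|extra_points|)%N.
  by rewrite card_single_points card_extra_points -mulnDl subnKC ?max_card.
rewrite -addnA -(cardsID single_points) setTI; congr (_ + _)%N.
rewrite -(cardsID [set c | #[val c * val (tau c)] == 3]); congr (_ + _)%N.
  by apply: eq_card => c; rewrite !inE andbT.
by apply: eq_card => c; rewrite !inE andbT andbC.
Qed.

Lemma order_mulC (gT : finGroupType) (x y : gT) : #[y * x] = #[x * y].
Proof. by rewrite -[RHS](orderJ _ x) conjgE -mulgA mulKg. Qed.

Lemma extra_points_flip c :
  c \in extra_points -> tau c \in extra_points /\ tau c != c.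
Proof.
rewrite !inE flipK [c == _]eq_sym => /andP[tc /eqP o3]; rewrite tc; split=> //=.
by rewrite order_mulC o3.
Qed.

Lemma double_points_flip c :
  c \in double_points -> tau c \in double_points /\ tau c != c.
Proof.
rewrite !inE flipK [c == _]eq_sym => /andP[tc o3]; rewrite tc; split=> //=.
by rewrite order_mulC o3.
Qed.

End FlipOrbits.

(** * Normal forms in the extraspecial group of order 27 and exponent 3 *)

Section Heisenberg.

Variables (P : finGroupType) (u v : P).
Hypotheses (P3 : forall x : P, x ^+ 3 = 1) (P27 : #|P| = 27).
Hypotheses (Pgen : <<[set u; v]>> = [set: P]).
Hypotheses (Pder : [set: P]^`(1) \subset 'Z([set: P])).

Local Notation w := [~ u, v].

Lemma comm_central : forall x, commute w x.
Proof.
have /subsetP/(_ w) := Pder; rewrite mem_commg ?inE // => /(_ isT)/andP[_ /centP cw] x.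
by apply: cw; rewrite inE.
Qed.

Lemma centralX t x : commute (w ^+ t) x.
Proof. exact/commute_sym/commuteX/commute_sym/comm_central. Qed.

Lemma expVg2 (x : P) m : x ^- m = x ^+ (2 * m).
Proof.
by apply/eqP; rewrite eq_invg_mul -expgD -mulSn expgM P3 expg1n.
Qed.

Lemma commXuv m n : [~ u ^+ m, v ^+ n] = w ^+ (m * n).
Proof.
by rewrite commXXg //; apply: commute_sym; apply: comm_central.
Qed.

Lemma swapuv m n : v ^+ n * u ^+ m = u ^+ m * v ^+ n * w ^- (m * n).
Proof.
rewrite -commXuv; have := commgC (u ^+ m) (v ^+ n) => ->.
by rewrite mulgK.
Qed.

Definition heis (r s t : nat) : P := u ^+ r * v ^+ s * w ^+ t.

Lemma heis_mod r s t : heis (r %% 3) (s %% 3) (t %% 3) = heis r s t.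
Proof. by rewrite /heis !expg_mod ?P3. Qed.

(** The elements in normal form are stable under right multiplication by the
    two generators. *)
Lemma heis_surj x : exists r s t, x = heis r s t.
Proof.
have /gen_prodgP[n [c uvc ->]] : x \in <<[set u; v]>> by rewrite Pgen inE.
elim: n c uvc => [|n IHn] c uvc.
  by exists 0, 0, 0; rewrite big_ord0 /heis !expg0 !mulg1.
have [|r [s [t]]] := IHn (fun i => c (widen_ord (leqnSn n) i)) => [i|E].
  exact: uvc.
rewrite big_ord_recr /= {}E; have /set2P[->|->] := uvc ord_max.
  (* Moving u across v^s costs w^-s, which is w^(2s) as w has order 3. *)
  exists r.+1, s, (t + 2 * s); rewrite /heis -[_ * u]mulgA (centralX t u).
  rewrite -mulgA [v ^+ s * _]mulgA -[X in v ^+ s * X]expg1 swapuv mul1n.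
  by rewrite expVg2 expg1 [u ^+ r.+1]expgSr [t + _]addnC [w ^+ (_ + t)]expgD !mulgA.
by exists r, s.+1, t; rewrite /heis -[_ * v]mulgA (centralX t v) expgSr !mulgA.
Qed.

Definition heisI (x : 'I_3 * 'I_3 * 'I_3) : P := heis x.1.1 x.1.2 x.2.

Lemma heisI_codom x : exists y, x = heisI y.
Proof.
have [r [s [t ->]]] := heis_surj x; rewrite -heis_mod.
pose o m : 'I_3 := Ordinal (ltn_pmod m (isT : 0 < 3)%N).
by exists (o r, o s, o t).
Qed.

(** There are 27 normal forms for 27 elements, so surjectivity is enough. *)
Lemma heisI_inj : injective heisI.
Proof.
apply/injectiveP/card_uniqP.
have -> : #|codom heisI| = #|P|.
  apply: eq_card => x; rewrite [RHS]inE; apply/codomP.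
  by have [y] := heisI_codom x; exists y.
by rewrite P27 size_codom !card_prod card_ord.
Qed.

Lemma heis_inj r s t r' s' t' : heis r s t = heis r' s' t' ->
  [/\ r = r' %[mod 3], s = s' %[mod 3] & t = t' %[mod 3]].
Proof.
rewrite -heis_mod -[RHS]heis_mod.
pose o m : 'I_3 := Ordinal (ltn_pmod m (isT : 0 < 3)%N).
move=> E; have: (o r, o s, o t) = (o r', o s', o t') by apply: heisI_inj.
by case.
Qed.

Variable sigma : {perm P}.
Hypotheses (sigma_aut : sigma \in Aut [set: P]).
Hypotheses (sigmau : sigma u = v) (sigmav : sigma v = u).

Lemma sigma_w : sigma w = w^-1.
Proof.
by rewrite invg_comm !commgEl /conjg !(autM sigma_aut, autV sigma_aut) sigmau sigmav.
Qed.

Lemma sigma_heis r s t : sigma (heis r s t) = v ^+ r * u ^+ s * w ^- t.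
Proof.
by rewrite /heis 2!(autM sigma_aut) !(autX sigma_aut) sigmau sigmav sigma_w expgVn.
Qed.

Lemma sigma_heis_swap r s t :
  sigma (heis r s t) = u ^+ s * v ^+ r * w ^- (t + s * r).
Proof.
by rewrite sigma_heis swapuv -mulgA -invMg -expgD.
Qed.

(** No power of w appears from reordering, since inverting reverses the factors:
    (v^r u^s w^-t)^-1 = u^-s v^-r w^t. *)
Lemma sigma_heisV r s t : (sigma (heis r s t))^-1 = heis (2 * s) (2 * r) t.
Proof.
by rewrite sigma_heis !invMg invgK !expVg2 [LHS]centralX.
Qed.

Lemma sigmaK : involutive sigma.
Proof.
move=> x; have [r [s [t ->]]] := heis_surj x.
rewrite sigma_heis 2!(autM sigma_aut) (autV sigma_aut) !(autX sigma_aut).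
by rewrite sigmau sigmav sigma_w expgVn invgK.
Qed.

Lemma heis_inverted r s t :
  (heis r s t \in inverted sigma) = ((r + s) %% 3 == 0)%N.
Proof.
rewrite inE -(inj_eq invg_inj) invgK sigma_heisV; apply/eqP/eqP.
  case/heis_inj => E1 E2 _.
  by rewrite -modnDml -E1 modnDml -mulSnr mulnC modnMl.
have E (a b : nat) : (a + b) %% 3 = 0 -> (2 * b)%N = a %[mod 3].
  by move=> ab; apply/eqP; rewrite -(eqn_modDr b) -mulSnr ab modnMr.
move=> rs0; rewrite -heis_mod -[RHS]heis_mod.
by rewrite (E r s rs0) (E s r) // addnC.
Qed.

Lemma card_inverted : #|inverted sigma| = 9.
Proof.
pose A := [set x : 'I_3 * 'I_3 * 'I_3 | (x.1.1 + x.1.2) %% 3 == 0].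
have -> : inverted sigma = heisI @: A.
  apply/setP=> g; have [x ->] := heisI_codom g.
  by rewrite mem_imset ?heis_inverted ?inE //; apply: heisI_inj.
rewrite card_imset; last exact: heisI_inj.
(* The condition determines s = -r = 2r modulo 3, leaving r and t free. *)
pose f (y : 'I_3 * 'I_3) : 'I_3 * 'I_3 * 'I_3 := (y.1, inZp (2 * y.1), y.2).
have f_inj : injective f by move=> [r t] [r' t'] [-> _ ->].
have -> : A = f @: [set: 'I_3 * 'I_3].
  apply/setP=> -[[r s] t]; rewrite inE; apply/eqP/imsetP => /=.
    move=> rs0; exists (r, t); first by rewrite inE.
    suff -> : s = inZp (2 * r) by [].
    apply: val_inj => /=.
    by case: r s rs0 => [[|[|[|?]]] ?] [[|[|[|?]]] ?].
  case=> -[r' t'] _.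
  move=> /(congr1 (fun x : 'I_3 * 'I_3 * 'I_3 => (x.1.1 + x.1.2) %% 3)) /= ->.
  by rewrite modnDmr -mulSn modnMr.
by rewrite card_imset // cardsT card_prod card_ord.
Qed.

End Heisenberg.

(** * The fixed subalgebra for the extraspecial group *)

Theorem proposition3p14 (F : fieldType) (eta : F)
    (hchar : 2%N \notin [pchar F]%R) (heta0 : eta != 0%R) (heta1 : eta != 1%R)
    (P : finGroupType) (hPextra : extraspecial [set: P])
    (hPcard : #|[set: P]| = 27) (hPexp : exponent [set: P] = 3)
    (u v w : P) (hPgen : <<[set u; v]>> = [set: P]) (hw : w = [~ u, v])
    (sigma : {perm P}) (hsigma : sigma \in Aut [set: P])
    (hsigma2 : #[sigma] = 2) (hsigmau : sigma u = v) (hsigmav : sigma v = u)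
    (k : nat) (hk : (1 <= k)%N) :
  (exists! tau, @flip_aut P sigma k tau) /\
  forall tau : {perm point (wr_class P (2 * k)%N)}, flip_aut sigma tau ->
  let H : {set {perm point (wr_class P (2 * k)%N)}} := <[tau]> in
  [/\
      forall (c : point (wr_class P (2 * k)%N)) (r s t : 'I_3)
             (i j : 'I_(2 * k)%N),
        i != j -> val c = wtrans (u ^+ r * v ^+ s * w ^+ t) i j ->
        val (tau c) = wtrans (v ^+ r * u ^+ s * w ^- t)
                             (pairing k i) (pairing k j) /\
        val (tau c) = wtrans (u ^+ s * v ^+ r * w ^- (t + s * r)%N)
                             (pairing k i) (pairing k j),
      #[tau] = 2,
      \dim (fixed_subalg F H) = (27 * k ^ 2 - 9 * k)%N
    & [/\
      (has_card (@is_single _ _ F H) (9 * k)%N /\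
       forall x : matsuo (wr_class P (2 * k)%N) F,
         is_single H x <->
         exists (r s t : 'I_3) (i : 'I_k),
           ((r + s) %% 3 = 0)%N /\
           x = bvec _ F (wtrans (u ^+ r * v ^+ s * w ^+ t)
                                (odd_idx i) (even_idx i))),
      (has_card (is_double eta H) (27 * k * (k - 1))%N /\
       forall x : matsuo (wr_class P (2 * k)%N) F,
         is_double eta H x <->
         exists (g : P) (i j : 'I_(2 * k)%N),
           [/\ i != j, pairing k i != j
             & x = (bvec _ F (wtrans g i j)
                    + bvec _ F (wtrans (sigma g)
                                       (pairing k i) (pairing k j)))%R])
    & (has_card (is_extra eta H) (9 * k)%N /\
       forall x : matsuo (wr_class P (2 * k)%N) F,
         is_extra eta H x <->
         exists (r s t : 'I_3) (i : 'I_k),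
           ((r + s) %% 3 <> 0)%N /\
           x = (bvec _ F (wtrans (u ^+ r * v ^+ s * w ^+ t)
                                 (odd_idx i) (even_idx i))
                + bvec _ F (wtrans (u ^+ (2 * s)%N * v ^+ (2 * r)%N * w ^+ t)
                                   (odd_idx i) (even_idx i)))%R)]].
Proof.
subst w; rewrite cardsT in hPcard.
have P3 (x : P) : x ^+ 3 = 1 by rewrite -hPexp expg_exponent ?inE.
have Pder : [set: P]^`(1) \subset 'Z([set: P]).
  by case: hPextra => -[_ ->] _.
have sK := sigmaK P3 hPgen Pder hsigma hsigmau hsigmav.
have sH := sigma_heis hsigma hsigmau hsigmav.
have sHs := sigma_heis_swap Pder hsigma hsigmau hsigmav.
have sHV := sigma_heisV P3 Pder hsigma hsigmau hsigmav.
have sHinv := heis_inverted P3 hPcard hPgen Pder hsigma hsigmau hsigmav.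
have inv9 := card_inverted P3 hPcard hPgen Pder hsigma hsigmau hsigmav.
have heisP (g : P) : exists r s t : 'I_3, g = heis u v r s t.
  have [[[r s] t] ->] := heisI_codom P3 hPgen Pder g.
  by exists r, s, t.
split=> [|tau tau_flip H]; first exact: flip_aut_exists_unique.
have tauK := flipK sK tau_flip.
have card_E : #|extra_points tau| = (9 * k * 2)%N.
  by rewrite (card_extra_points P3 tau_flip) hPcard inv9 mulnAC.
have tau1 : tau != 1.
  apply/eqP => tau1; have : 0 < #|extra_points tau| by rewrite card_E !muln_gt0 hk.
  by case/card_gt0P=> c; rewrite inE tau1 perm1 eqxx.
have card_B : #|double_points tau| = (27 * k * (k - 1) * 2)%N.
  by rewrite (card_double_points P3 tau_flip) hPcard; lia.
have card_S : #|single_points tau| = (9 * k)%N.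
  by rewrite (card_single_points tau_flip) inv9.
split.
- move=> c r s t i j ij Ec; case: (tau_flip) => _ Htau.
  have -> := Htau c _ i j ij Ec; rewrite -/(heis u v r s t).
  by rewrite {1}sH sHs.
- by rewrite /order cycle_involution // cards2 eq_sym tau1.
- apply/eqP; rewrite -(eqn_pmul2r (isT : 0 < 2)%N) dim_fixed_involution //.
  rewrite (card_points P3 tau_flip) -/(single_points tau) card_S hPcard.
  by rewrite -(ltn_predK hk); lia.
split; split.
- rewrite -card_S; apply: has_card_fixed => // x; exact: is_singleP.
- move=> x; apply: (iff_trans (is_singleP tauK x)); split.
    case=> a /(flip_fixedP tau_flip)[g [i [ginv Ea]]] ->.
    have [r [s [t Eg]]] := heisP g; exists r, s, t, i; rewrite Ea Eg.
    by rewrite Eg sHinv in ginv; split=> //; apply/eqP.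
  case=> r [s [t [i [rs0 ->]]]].
  have [c Ec] := wtrans_point (heis u v r s t) (odd_even_neq i i).
  exists c; last by rewrite Ec.
  apply/(flip_fixedP tau_flip); exists (heis u v r s t), i.
  by rewrite sHinv rs0.
- apply: (has_card_moved tauK _ card_B) => [a|x]; first exact: double_points_flip.
  apply: (iff_trans (is_doubleP hchar heta0 tauK x)); split.
    by case=> a [ta o3 ->]; exists a; rewrite // inE ta.
  by case=> a; rewrite inE => /andP[ta o3] ->; exists a.
- move=> x; apply: (iff_trans (is_doubleP hchar heta0 tauK x)); split.
    case=> a [ta o3 ->].
    have [g [i [j [ij pij Ea]]]] := (flip_doubleP P3 tau_flip a).1 (conj ta o3).
    by exists g, i, j; rewrite -(flip_unmatched tau_flip ij Ea) -Ea.
  case=> g [i [j [ij pij ->]]].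
  have [c Ec] := wtrans_point g ij.
  have [|tc o3] := (flip_doubleP P3 tau_flip c).2; first by exists g, i, j.
  by exists c; rewrite -(flip_unmatched tau_flip ij Ec) -Ec; split.
- apply: (has_card_moved tauK _ card_E) => [a|x]; first exact: extra_points_flip.
  apply: (iff_trans (is_extraP hchar heta0 tauK x)); split.
    by case=> a [ta o3 ->]; exists a; rewrite // inE ta o3.
  by case=> a; rewrite inE => /andP[ta /eqP o3] ->; exists a.
- move=> x; apply: (iff_trans (is_extraP hchar heta0 tauK x)); split.
    case=> a [ta o3 ->].
    have [g [i [ginv Ea]]] := (flip_extraP P3 tau_flip a).1 (conj ta o3).
    have [r [s [t Eg]]] := heisP g; exists r, s, t, i.
    split; first by rewrite Eg sHinv in ginv; apply/eqP.
    by rewrite (flip_matched tau_flip Ea) Ea Eg sHV.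
  case=> r [s [t [i [rs0 ->]]]].
  have [c Ec] := wtrans_point (heis u v r s t) (odd_even_neq i i).
  have [|tc o3] := (flip_extraP P3 tau_flip c).2.
    by exists (heis u v r s t), i; rewrite sHinv; split=> //; apply/eqP.
  exists c; rewrite -/(heis u v (2 * s) (2 * r) t) -sHV.
  by rewrite -(flip_matched tau_flip Ec) -Ec; split.
Qed.
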